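(* Let $S$ be a finite nonempty set, let $1\le k<n$ be integers, let $\phi$ be the parametrization map of the nonhomogeneous $k$-th order multistate Markov model on $S$ for paths of length $n$, and let $\Theta$ be the set of parameters satisfying the statistical constraints. Then $$\phi(\Theta)=\phi\Bigl(\mathbb{R}^{S^k}\times\prod_{\ell=k+1}^n\mathbb{R}^{S^{k+1}}\Bigr)\cap\Delta_{|S|^n-1}.$$
   Context: Points of $\mathbb{R}^{S^k}\times\prod_{\ell=k+1}^n\mathbb{R}^{S^{k+1}}$ are written $(\pi,a)$ with real coordinates $\pi_{i_1\ldots i_k}$ ($(i_1,\dots,i_k)\in S^k$) and $a^{(\ell)}_{i_{\ell-k}\cdots i_\ell}$ ($\ell=k+1,\dots,n$, $(i_{\ell-k},\dots,i_\ell)\in S^{k+1}$). The map $\phi$ to $\mathbb{R}^{S^n}$ is $$\phi_{i_1\ldots i_n}(\pi,a)=\pi_{i_1\ldots i_k}\prod_{\ell=k+1}^n a^{(\ell)}_{i_{\ell-k}\cdots i_{\ell-1}i_\ell}.$$ $\Theta$ is the set of all $(\pi,a)$ such that all $\pi_{i_1\ldots i_k}\ge0$, $\sum_{i_1,\dots,i_k\in S}\pi_{i_1\ldots i_k}=1$, all $a^{(\ell)}_{i_{\ell-k}\cdots i_\ell}\ge 0$, and $\sum_{i_\ell\in S}a^{(\ell)}_{i_{\ell-k}\cdots i_{\ell-1}i_\ell}=1$ for all $\ell\in\{k+1,\dots,n\}$ and all $i_{\ell-k},\dots,i_{\ell-1}\in S$. $\Delta_{|S|^n-1}\subset\mathbb{R}^{S^n}$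 is the probability simplex of vectors with nonnegative entries summing to $1$. *)

(* Defs.v *)
From mathcomp Require Import all_boot all_order all_algebra.
From mathcomp Require Import boolp classical_sets reals.

Set Implicit Arguments.
Unset Strict Implicit.
Unset Printing Implicit Defensive.

Import Order.TTheory GRing.Theory Num.Theory.
Local Open Scope ring_scope.
Local Open Scope classical_set_scope.

Lemma window_bound (n j m : nat) (le_jm_n : (j + m <= n)%N) (s : 'I_m) :
  (j + s < n)%N.
Proof. by apply: leq_trans le_jm_n; rewrite ltn_add2l. Qed.

(* Tuples are 0-based: (i_1, ..., i_n) |-> (i_{j+1}, ..., i_{j+m}). *)
Definition window (S : finType) (n j m : nat) (le_jm_n : (j + m <= n)%N)
    (i : n.-tuple S) : m.-tuple S :=
  [tuple tnth i (Ordinal (window_bound le_jm_n s)) | s < m].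

(* Pairs (pi, a).  The index l in {k+1, ..., n} of the transition tensor a^(l)
   is represented by j = l - (k + 1) in 'I_(n - k). *)
Definition params (R : realType) (S : finType) (k n : nat) : Type :=
  ({ffun k.-tuple S -> R} * {ffun 'I_(n - k) -> {ffun k.+1.-tuple S -> R}})%type.

Lemma transition_bound (k n : nat) (j : 'I_(n - k)) : (j + k.+1 <= n)%N.
Proof. by rewrite addnS addnC -ltn_subRL. Qed.

(* With l = j + k + 1, the window of length k + 1 starting after position j is
   (i_{l-k}, ..., i_l). *)
Definition phi (R : realType) (S : finType) (k n : nat) (lt_kn : (k < n)%N)
    (x : params R S k n) : {ffun n.-tuple S -> R} :=
  [ffun i : n.-tuple S =>
     x.1 (@window S n 0 k (ltnW lt_kn) i) *
     \prod_(j < n - k) x.2 j (window (transition_bound j) i)].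

Definition Theta (R : realType) (S : finType) (k n : nat) :
    set (params R S k n) :=
  [set x : params R S k n |
    [/\ forall c, 0 <= x.1 c,
        \sum_(c : k.-tuple S) x.1 c = 1,
        forall (j : 'I_(n - k)) w, 0 <= x.2 j w &
        forall (j : 'I_(n - k)) (c : k.-tuple S),
          \sum_(s : S) x.2 j [tuple of rcons c s] = 1]].

Definition prob_simplex (R : realType) (T : finType) : set {ffun T -> R} :=
  [set p | (forall t, 0 <= p t) /\ \sum_(t : T) p t = 1].

Arguments Theta : clear implicits.
Arguments prob_simplex : clear implicits.

(* Main.v *)
Require Import Defs.
From mathcomp Require Import all_boot all_order all_algebra.
From mathcomp Require Import boolp classical_sets reals.

(** Let [p = phi x] be a probability vector. As [p >= 0], [p = |p| = phi |x|],
so [x] may be assumed nonnegative. Put [b_n(c) = 1] and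
[b_l(c) = \sum_s a^(l+1)(c s) b_(l+1)(tail (c s))]; then [p] is unchanged when
[pi] is replaced by [pi b_k] and each [a^(l+1)(c s)] by
[a^(l+1)(c s) b_(l+1)(tail (c s)) / b_l(c)], or by the uniform law where
[b_l(c) = 0]: in that case nonnegativity makes every numerator vanish. The new
transitions are stochastic, so the new [pi] has the same total mass as [p]. *)

Set Implicit Arguments.
Unset Strict Implicit.
Unset Printing Implicit Defensive.

Import Order.TTheory GRing.Theory Num.Theory.
Local Open Scope ring_scope.

(* The window of length [m] starting after position [j]. Working with sequences
   and natural-number indices avoids casts between tuple types. *)
Definition infix_at (T : Type) (m j : nat) (s : seq T) : seq T :=
  take m (drop j s).

Lemma size_infix_at (T : Type) (m j : nat) (s : seq T) :
  (j + m <= size s)%N -> size (infix_at m j s) = m.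
Proof.
move=> le_jm; rewrite /infix_at size_take_min size_drop.
by apply/minn_idPl; rewrite leq_subRL // (leq_trans (leq_addr _ _) le_jm).
Qed.

Lemma take_infix_at (T : Type) (k j : nat) (s : seq T) :
  take k (infix_at k.+1 j s) = infix_at k j s.
Proof. by rewrite /infix_at take_takel. Qed.

Lemma behead_infix_at (T : Type) (k j : nat) (s : seq T) :
  behead (infix_at k.+1 j s) = infix_at k j.+1 s.
Proof.
rewrite /infix_at -[j.+1]add1n -drop_drop.
by case: (drop j s) => //= x t; rewrite drop0.
Qed.

Lemma infix_at_rcons_eq (T : Type) (m j : nat) (s : seq T) (x : T) :
  (j + m <= size s)%N -> infix_at m j (rcons s x) = infix_at m j s.
Proof.
move=> le_jm; have le_j := leq_trans (leq_addr _ _) le_jm.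
by rewrite /infix_at drop_rcons // -cats1 takel_cat // size_drop leq_subRL.
Qed.

Lemma infix_at_rcons_last (T : Type) (m j : nat) (s : seq T) (x : T) :
  size s = (j + m)%N ->
  infix_at m.+1 j (rcons s x) = rcons (infix_at m j s) x.
Proof.
move=> sz; have sz_drop : size (drop j s) = m by rewrite size_drop sz addKn.
rewrite /infix_at drop_rcons ?sz ?leq_addr // !take_oversize //.
  by rewrite sz_drop.
by rewrite size_rcons sz_drop.
Qed.

Lemma val_window (S : finType) (n j m : nat) (le_jm : (j + m <= n)%N)
    (i : n.-tuple S) :
  val (window le_jm i) = infix_at m j i.
Proof.
have sz : size (infix_at m j i) = m by rewrite size_infix_at // size_tuple.
(* For [m = 0] the type [S] may be empty; otherwise an entry of [i] serves as the default of
   [nth]. *)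
have [m0|m_gt0] := posnP m.
  by subst m; rewrite /infix_at take0; apply: size0nil; rewrite size_tuple.
pose s0 : S := tnth i (Ordinal (window_bound le_jm (Ordinal m_gt0))).
apply: (@eq_from_nth _ s0) => [|r]; rewrite size_tuple ?sz // => lt_rm.
rewrite -[r]/(val (Ordinal lt_rm)) -tnth_nth tnth_mktuple (tnth_nth s0) /=.
by rewrite /infix_at nth_take // nth_drop.
Qed.

Lemma sum_tuple_rcons (V : nmodType) (S : finType) (m : nat) (F : seq S -> V) :
  \sum_(t : m.+1.-tuple S) F t = \sum_(t : m.-tuple S) \sum_(s : S) F (rcons t s).
Proof.
rewrite pair_big /=.
rewrite (reindex (fun u : m.-tuple S * S => [tuple of rcons u.1 u.2])) //=.
(* The inverse of appending a letter; [thead] and [behead] expose the nonempty shape that [belast]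
   and [last] require. *)
pose f (t : m.+1.-tuple S) : m.-tuple S * S :=
  ([tuple of belast (thead t) (behead t)], last (thead t) (behead t)).
exists f => [[t s] _|t _]; last first.
  by apply: val_inj; case/tupleP: t => x t /=; rewrite theadE -lastI.
rewrite /f /=; congr pair.
  by apply: val_inj; rewrite /= /thead !(tnth_nth s) /=; case: (val t) => //= x u;
     rewrite belast_rcons.
by rewrite /thead !(tnth_nth s) /=; case: (val t) => //= x u; rewrite last_rcons.
Qed.

(** The monomial of [phi], with total functions on sequences as data so that induction on the number
    of steps [N] needs no casts. *)
Definition markov_weight (R : pzSemiRingType) (S : Type) (k N : nat)
    (P : seq S -> R) (A : nat -> seq S -> R) (s : seq S) : R :=
  P (take k s) * \prod_(0 <= j < N) A j (infix_at k.+1 j s).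

(** Summing over the last letter first removes the last factor, the only one that depends on it. *)
Lemma sum_markov_weight (R : pzSemiRingType) (S : finType) (k N n : nat)
    (P : seq S -> R) (A : nat -> seq S -> R) :
  (k + N)%N = n ->
  (forall (j : nat) (c : k.-tuple S), (j < N)%N ->
    \sum_(s : S) A j (rcons c s) = 1) ->
  \sum_(t : n.-tuple S) markov_weight k N P A t = \sum_(c : k.-tuple S) P c.
Proof.
elim: N n => [|N IH] n; rewrite ?addn0 ?addnS => <- sumA.
  apply: eq_bigr => t _.
  by rewrite /markov_weight big_nil mulr1 take_oversize // size_tuple.
rewrite -(IH _ erefl) => [|j c lt_jN]; last by apply: sumA; rewrite leqW.
rewrite sum_tuple_rcons; apply: eq_bigr => t _.
have sz_t : size t = (N + k)%N by rewrite size_tuple addnC.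
have sz_c : size (infix_at k N t) == k by rewrite size_infix_at ?sz_t.
(* The row of the last step is indexed by the final [k] letters of [t]; its sum 1 is inserted on the
   right. *)
rewrite -[RHS]mulr1 -(sumA N (Tuple sz_c)) // mulr_sumr; apply: eq_bigr => s _.
rewrite /markov_weight big_nat_recr //= mulrA infix_at_rcons_last //.
rewrite -cats1 takel_cat ?sz_t ?leq_addl // cats1; congr (_ * _ * _).
apply: eq_big_nat => j lt_jN; rewrite infix_at_rcons_eq //.
by rewrite sz_t addnS -addSn leq_add2r.
Qed.

(* [backward A m j c] is the total weight of the [m] steps numbered
   [j, ..., j + m - 1] over all continuations of the current state [c]. *)
Fixpoint backward (R : pzSemiRingType) (S : finType) (A : nat -> seq S -> R)
    (m j : nat) (c : seq S) : R :=
  if m is m'.+1 then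
    \sum_(s : S) A j (rcons c s) * backward A m' j.+1 (behead (rcons c s))
  else 1.

Lemma backward_ge0 (R : numDomainType) (S : finType) (A : nat -> seq S -> R)
    (m j : nat) (c : seq S) :
  (forall i w, 0 <= A i w) -> 0 <= backward A m j c.
Proof.
move=> A_ge0; elim: m j c => [|m IH] j c /=; first exact: ler01.
by apply: sumr_ge0 => s _; rewrite mulr_ge0.
Qed.

(** The Doob transform of [A] by [backward]; [N - j] steps remain before step [j] is taken. *)
Definition renormalized (R : fieldType) (S : finType) (k N : nat)
    (A : nat -> seq S -> R) (j : nat) (w : seq S) : R :=
  let b := backward A (N - j) j (take k w) in
  if b == 0 then (#|S|%:R)^-1
  else A j w * backward A (N - j.+1) j.+1 (behead w) / b.

Lemma renormalized_ge0 (R : numFieldType) (S : finType) (k N : nat)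
    (A : nat -> seq S -> R) (j : nat) (w : seq S) :
  (forall i v, 0 <= A i v) -> 0 <= renormalized k N A j w.
Proof.
move=> A_ge0; rewrite /renormalized; case: ifP => _; first by rewrite invr_ge0.
by rewrite divr_ge0 ?mulr_ge0 ?backward_ge0.
Qed.

Lemma sum_renormalized (R : numFieldType) (S : finType) (k N : nat)
    (A : nat -> seq S -> R) (j : nat) (c : k.-tuple S) :
  (0 < #|S|)%N -> (j < N)%N ->
  \sum_(s : S) renormalized k N A j (rcons c s) = 1.
Proof.
move=> S_gt0 lt_jN.
under eq_bigr => s _.
  rewrite /renormalized -[rcons c s]cats1 takel_cat ?size_tuple //.
  rewrite take_oversize ?size_tuple // cats1; over.
rewrite /=; have [b0|b_neq0] := eqVneq (backward A (N - j) j c) 0.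
  by rewrite sumr_const -[LHS]mulr_natl mulfV // pnatr_eq0 -lt0n.
(* Writing [N - j] as a successor unfolds [backward], so the denominator becomes the sum of the
   numerators. *)
by rewrite -mulr_suml; move: b_neq0; rewrite -(subnSK lt_jN) => /mulfV.
Qed.

Lemma backward_mul_renormalized (R : numFieldType) (S : finType) (k N : nat)
    (A : nat -> seq S -> R) (j : nat) (w : seq S) :
  (forall i v, 0 <= A i v) -> (j < N)%N -> size w = k.+1 ->
  backward A (N - j) j (take k w) * renormalized k N A j w =
  A j w * backward A (N - j.+1) j.+1 (behead w).
Proof.
move=> A_ge0 lt_jN sz_w; rewrite /renormalized.
case: eqP => [b0|/eqP b_neq0]; last by rewrite mulrC divfK.
rewrite b0 mul0r.
(* Splitting off the last letter of [w] exhibits the right-hand side as one term of the vanishing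
   nonnegative sum. *)
have def_w s0 : w = rcons (take k w) (nth s0 w k).
  by rewrite -take_nth ?sz_w // take_oversize ?sz_w.
have s0 : S by case: w sz_w {b0 def_w}.
move: b0; rewrite -(subnSK lt_jN) /=.
move/eqP; rewrite psumr_eq0 => [/allP/(_ (nth s0 w k))|s _]; last first.
  by rewrite mulr_ge0 ?backward_ge0.
by rewrite mem_index_enum -def_w => /(_ isT)/eqP.
Qed.

(** The product telescopes: each step trades the backward weight of the current state for that of
    the next, and the last one is 1. *)
Lemma markov_weight_renormalized (R : numFieldType) (S : finType) (k N : nat)
    (P : seq S -> R) (A : nat -> seq S -> R) (s : seq S) :
  (forall i v, 0 <= A i v) -> size s = (k + N)%N ->
  markov_weight k N (fun c => P c * backward A N 0 c) (renormalized k N A) s =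
  markov_weight k N P A s.
Proof.
move=> A_ge0 sz_s; rewrite /markov_weight -mulrA; congr (_ * _).
suff tele m : (m <= N)%N ->
    backward A N 0 (take k s) *
      \prod_(0 <= j < m) renormalized k N A j (infix_at k.+1 j s) =
    (\prod_(0 <= j < m) A j (infix_at k.+1 j s)) *
      backward A (N - m) m (infix_at k m s).
  by rewrite tele // subnn mulr1.
elim: m => [|m IH] le_mN.
  by rewrite !big_nil mulr1 mul1r subn0 /infix_at drop0.
rewrite !big_nat_recr //= mulrA IH ?(ltnW le_mN) // -!mulrA; congr (_ * _).
rewrite -take_infix_at backward_mul_renormalized // ?behead_infix_at //.
by rewrite size_infix_at // sz_s addnS addnC -addnS leq_add2l.
Qed.

Definition tuple_ext (V : nmodType) (S : Type) (m : nat) (f : m.-tuple S -> V)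
    (s : seq S) : V := oapp f 0 (insub s).

Lemma tuple_extE (V : nmodType) (S : Type) (m : nat) (f : m.-tuple S -> V)
    (t : m.-tuple S) : tuple_ext f t = f t.
Proof. by rewrite /tuple_ext valK. Qed.

Definition ord_ext (V : nmodType) (S : Type) (N : nat) (f : 'I_N -> seq S -> V)
    (j : nat) (s : seq S) : V := oapp (f ^~ s) 0 (insub j).

Lemma ord_extE (V : nmodType) (S : Type) (N : nat) (f : 'I_N -> seq S -> V)
    (j : 'I_N) (s : seq S) : ord_ext f j s = f j s.
Proof. by rewrite /ord_ext valK. Qed.

(** [P] and [A] are constrained on tuples only, so both zero extensions and renormalized data can
    represent a parameter. *)
Lemma phi_markov_weight (R : realType) (S : finType) (k n : nat)
    (lt_kn : (k < n)%N) (x : params R S k n)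
    (P : seq S -> R) (A : nat -> seq S -> R) (i : n.-tuple S) :
  (forall c, P (val c) = x.1 c) ->
  (forall (j : 'I_(n - k)) w, A j (val w) = x.2 j w) ->
  phi lt_kn x i = markov_weight k (n - k) P A i.
Proof.
move=> PE AE; rewrite ffunE /markov_weight -PE val_window /infix_at drop0.
congr (_ * _); rewrite big_mkord; apply: eq_bigr => j _.
by rewrite -AE val_window.
Qed.

Lemma sum_phi (R : realType) (S : finType) (k n : nat) (lt_kn : (k < n)%N)
    (x : params R S k n) :
  (forall (j : 'I_(n - k)) (c : k.-tuple S),
    \sum_(s : S) x.2 j [tuple of rcons c s] = 1) ->
  \sum_(i : n.-tuple S) phi lt_kn x i = \sum_(c : k.-tuple S) x.1 c.
Proof.
move=> sum_x2; pose P := tuple_ext x.1.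
pose A := ord_ext (fun j => tuple_ext (x.2 j)).
have PE c : P (val c) = x.1 c by rewrite /P tuple_extE.
have AE (j : 'I_(n - k)) w : A j (val w) = x.2 j w.
  by rewrite /A ord_extE tuple_extE.
rewrite (eq_bigr _ (fun i _ => phi_markov_weight lt_kn i PE AE)).
rewrite sum_markov_weight ?(subnKC (ltnW lt_kn)) // => [|j c lt_jN].
  by apply: eq_bigr => c _; rewrite PE.
rewrite -(sum_x2 (Ordinal lt_jN) c).
by apply: eq_bigr => s _; rewrite -AE.
Qed.

Local Open Scope classical_set_scope.

Theorem proposition4p9 (R : realType) (S : finType) (k n : nat)
    (S_nonempty : (0 < #|S|)%N) (k_ge1 : (1 <= k)%N) (lt_kn : (k < n)%N) :
  phi lt_kn @` Theta R S k n =
  phi lt_kn @` [set: params R S k n] `&` prob_simplex R (n.-tuple S).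
Proof.
apply/seteqP; split => [_ [x [x1_ge0 sum_x1 x2_ge0 sum_x2] <-]|].
  split; first by exists x.
  split; last by rewrite sum_phi.
  by move=> i; rewrite ffunE mulr_ge0 // prodr_ge0.
move=> _ [[x _ <-]] [p_ge0 sum_p].
pose P (c : seq S) := `|tuple_ext x.1 c|.
pose A (j : nat) (w : seq S) := `|ord_ext (fun j => tuple_ext (x.2 j)) j w|.
have A_ge0 j w : 0 <= A j w by exact: normr_ge0.
pose y : params R S k n :=
  ([ffun c : k.-tuple S => P c * backward A (n - k) 0 c],
   [ffun j : 'I_(n - k) => [ffun w : k.+1.-tuple S => renormalized k (n - k) A j w]]).
have sum_y2 (j : 'I_(n - k)) (c : k.-tuple S) :
    \sum_(s : S) y.2 j [tuple of rcons c s] = 1.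
  rewrite -(sum_renormalized A c S_nonempty (ltn_ord j)).
  by apply: eq_bigr => s _; rewrite !ffunE.
have phi_y : phi lt_kn y = phi lt_kn x.
  (* Nonnegativity of [phi lt_kn x] is used here: it equals its absolute value, which is the weight
     built from [P] and [A]. *)
  apply/ffunP => i; rewrite -[RHS]ger0_norm //.
  rewrite (@phi_markov_weight _ _ _ _ _ y (fun c => P c * backward A (n - k) 0 c)
    (renormalized k (n - k) A)); first last.
  - by move=> j w; rewrite !ffunE.
  - by move=> c; rewrite ffunE.
  rewrite markov_weight_renormalized ?size_tuple ?subnKC // 1?ltnW //.
  rewrite (@phi_markov_weight _ _ _ _ _ x (tuple_ext x.1)
    (ord_ext (fun j => tuple_ext (x.2 j)))); first last.
  - by move=> j w; rewrite ord_extE tuple_extE.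
  - by move=> c; rewrite tuple_extE.
  by rewrite /markov_weight normrM normr_prod.
exists y => //; split=> //.
- by move=> c; rewrite ffunE mulr_ge0 ?normr_ge0 ?backward_ge0.
(* The mass of the new initial vector is read off from the total mass of its image. *)
- by rewrite -(sum_phi lt_kn sum_y2) phi_y.
- by move=> j w; rewrite !ffunE renormalized_ge0.
Qed.
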